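(* Let $0<a<c\le 1$. The function $f(x)=\mu_{a,c}(1/\cosh(x))$ is increasing and concave from $(0,\infty)$ onto $(0,\infty)$. In particular, $$\mu_{a,c}\left(\frac{rs}{1+r's'}\right)\le \mu_{a,c}(r)+\mu_{a,c}(s)\le 2\mu_{a,c}\left(\sqrt{\frac{2rs}{1+rs+r's'}}\right)$$ for all $r,s\in(0,1)$, where $r'=\sqrt{1-r^2}$ and $s'=\sqrt{1-s^2}$. The second inequality becomes equality if and only if $r=s$.
   Context: $F(a,b;c;z)=\sum_{n=0}^\infty \frac{(a,n)(b,n)}{(c,n)}\frac{z^n}{n!}$ for $|z|<1$ is the Gaussian hypergeometric function, where $(a,0)=1$ and $(a,n)=a(a+1)\cdots(a+n-1)$ for $n\ge 1$, and $B(x,y)=\Gamma(x)\Gamma(y)/\Gamma(x+y)$ is the beta function. For $0<a<c$ and $r\in(0,1)$, $$\mu_{a,c}(r)=\frac{B(a,c-a)}{2}\,\frac{F(a,c-a;c;1-r^2)}{F(a,c-a;c;r^2)},$$ a decreasing homeomorphism of $(0,1)$ onto $(0,\infty)$. *)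

(* Defs.v *)
From Stdlib Require Import Reals Factorial.
From Coquelicot Require Import Coquelicot.
Open Scope R_scope.

(** The shifted factorial (a,n) = a (a+1) ... (a+n-1). *)
Fixpoint pochhammer (a : R) (n : nat) : R :=
  match n with
  | O => 1
  | S m => pochhammer a m * (a + INR m)
  end.

(** Meaningful for |z| < 1 and c not a nonpositive integer. *)
Definition hyp2F1 (a b c z : R) : R :=
  PSeries
    (fun n => pochhammer a n * pochhammer b n / (pochhammer c n * INR (fact n)))
    z.

(** Euler's integral, improper at both endpoints; meaningful for 0 < x. *)
Definition Gamma (x : R) : R :=
  RInt_gen (fun t => Rpower t (x - 1) * exp (- t))
    (at_right 0) (Rbar_locally p_infty).

Definition Beta (x y : R) : R := Gamma x * Gamma y / Gamma (x + y).

(** Meaningful for 0 < a < c and 0 < r < 1. *)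
Definition mu (a c r : R) : R :=
  Beta a (c - a) / 2 *
  (hyp2F1 a (c - a) c (1 - r ^ 2) / hyp2F1 a (c - a) c (r ^ 2)).

(** "Increasing" is strict. *)
Definition increasing_on (D : R -> Prop) (f : R -> R) : Prop :=
  forall x y, D x -> D y -> x < y -> f x < f y.

(** To be used with a convex set D. *)
Definition concave_on (D : R -> Prop) (f : R -> R) : Prop :=
  forall x y t, D x -> D y -> 0 <= t <= 1 ->
    t * f x + (1 - t) * f y <= f (t * x + (1 - t) * y).

Definition maps_onto (D E : R -> Prop) (f : R -> R) : Prop :=
  (forall x, D x -> E (f x)) /\
  (forall y, E y -> exists x, D x /\ f x = y).

(* Main.v *)
Require Import Defs.
From Stdlib Require Import Reals.
From Coquelicot Require Import Coquelicot.
From Stdlib Require Import Factorial Lra Lia Ranalysis5.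
Open Scope R_scope.

(** Put b = c - a, F(u) = F(a,b;a+b;u) and u = 1/cosh(x)^2, so that
    f(x) = mu_{a,c}(1/cosh x) = (B(a,b)/2) F(1-u)/F(u).

    The proof rests on the companion series K(u) = (1-u) F'(u).  Because the
    series is zero-balanced (c = a+b), the coefficients of K are those of F
    multiplied by ab/(c+n), and the hypergeometric equation splits into

      F' = K/(1-u),    u K' = ab F - c K.

    Differentiating f gives f'(x) = B(a,b) q(u) with

      q(u) = p(u) / (sqrt(1-u) F(u)^2),
      p(u) = u K(u) F(1-u) + (1-u) F(u) K(1-u),

    which is positive.  As u decreases in x, strict concavity of f amounts to
    q being strictly increasing.  The first-order system gives
    p'(u) = (1-c) (K(u)F(1-u) - F(u)K(1-u)), so q' has the sign of

      (1-c) (1-u) (K(u)F(1-u) - F(u)K(1-u)) + p(u) (1/2 - 2 K(u)/F(u)).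

    Since K/F < ab/c <= c/4, the last factor exceeds (1-c)/2.  For u <= 1/2 the
    first term is nonnegative as K/F decreases.  For u >= 1/2 the surplus
    (1-c) p/2 absorbs it as F'/F increases.  Both monotonicity facts
    compare power series whose quotients of coefficients are monotone
    (Biernacki and Krzyz), see [PSeries_cross_le].

    Surjectivity comes from the logarithmic divergence of F at 1, read off from
    F' = K/(1-u) >= (ab/c)/(1-u).  The inequalities for r and s are, after
    r = 1/cosh(x) and s = 1/cosh(y), the subadditivity of a positive concave
    function and its midpoint concavity, strict for x <> y.  Of the beta factor
    only the positivity matters, which requires that the improper integrals
    defining Gamma converge. *)

(** * Comparison of power series *)

Lemma PSeries_ge0 (a : nat -> R) (x : R) :
  0 <= x -> ex_pseries a x -> (forall n, 0 <= a n) -> 0 <= PSeries a x.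
Proof.
  intros Hx Hex Ha.
  assert (Hterm : forall n, 0 <= a n * x ^ n).
  { intros n; apply Rmult_le_pos; [apply Ha | now apply pow_le]. }
  replace 0 with (Series (fun n => 0 * (a n * x ^ n)))
    by (rewrite Series_scal_l; ring).
  apply Series_le.
  - intros n; specialize (Hterm n); lra.
  - destruct Hex as [l Hl]; exists l; now apply is_pseries_R.
Qed.

(** Keeping the linear term makes termwise comparisons of two series strict
    when x > 0, as in [zbK_lt_zbF]. *)
Lemma PSeries_ge_affine (a : nat -> R) (x : R) :
  0 <= x -> Rbar_lt (Rabs x) (CV_radius a) -> (forall n, 0 <= a n) ->
  a 0%nat + a 1%nat * x <= PSeries a x.
Proof.
  intros Hx Hcv Ha.
  assert (Hcv1 : Rbar_lt (Rabs x) (CV_radius (PS_decr_1 a)))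
    by now rewrite CV_radius_decr_1.
  assert (Hcv2 : Rbar_lt (Rabs x) (CV_radius (PS_decr_1 (PS_decr_1 a))))
    by now rewrite CV_radius_decr_1.
  rewrite (PSeries_decr_1 a) by now apply CV_radius_inside.
  rewrite (PSeries_decr_1 (PS_decr_1 a)) by now apply CV_radius_inside.
  assert (Htail : 0 <= PSeries (PS_decr_1 (PS_decr_1 a)) x).
  { apply PSeries_ge0; [easy | now apply CV_radius_inside |].
    intros n; apply Ha. }
  unfold PS_decr_1 at 1.
  assert (0 <= x * (x * PSeries (PS_decr_1 (PS_decr_1 a)) x))
    by (repeat apply Rmult_le_pos; easy).
  lra.
Qed.

(** The difference of the two sides is the sum over n < m of
    (a_m b_n - a_n b_m) (y^m x^n - x^m y^n), a sum of products of two
    nonnegative factors. *)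
Lemma partial_sums_cross_le (a b : nat -> R) (x y : R) (N : nat) :
  0 <= x <= y ->
  (forall m n, (n <= m)%nat -> a n * b m <= a m * b n) ->
  sum_f_R0 (fun n => a n * x ^ n) N * sum_f_R0 (fun n => b n * y ^ n) N <=
  sum_f_R0 (fun n => a n * y ^ n) N * sum_f_R0 (fun n => b n * x ^ n) N.
Proof.
  intros Hxy Hab.
  (* the terms of row N+1 and of column N+1, paired across the diagonal *)
  assert (Hrow : forall N k, (k < N)%nat ->
    sum_f_R0 (fun n => a n * x ^ n) k * (b N * y ^ N)
      + a N * x ^ N * sum_f_R0 (fun n => b n * y ^ n) k <=
    sum_f_R0 (fun n => a n * y ^ n) k * (b N * x ^ N)
      + a N * y ^ N * sum_f_R0 (fun n => b n * x ^ n) k).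
  { assert (Hpair : forall M n, (n < M)%nat ->
      a n * x ^ n * (b M * y ^ M) + a M * x ^ M * (b n * y ^ n) <=
      a n * y ^ n * (b M * x ^ M) + a M * y ^ M * (b n * x ^ n)).
    { intros M n HnM.
      assert (Hpow : x ^ M * y ^ n <= y ^ M * x ^ n).
      { replace M with (n + (M - n))%nat by lia.
        rewrite !pow_add.
        assert (x ^ (M - n) <= y ^ (M - n)) by (apply pow_incr; lra).
        assert (0 <= x ^ n * y ^ n)
          by (apply Rmult_le_pos; apply pow_le; lra).
        nra. }
      assert (Hc := Hab M n ltac:(lia)).
      nra. }
    intros M k; induction k as [|k IH]; intros Hk.
    - simpl sum_f_R0; now apply Hpair.
    - rewrite !tech5. specialize (IH ltac:(lia)).
      specialize (Hpair M (S k) Hk). nra. }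
  induction N as [|N IH].
  - simpl; lra.
  - specialize (Hrow (S N) N ltac:(lia)).
    rewrite !tech5. nra.
Qed.

(** The Biernacki-Krzyz criterion, cleared of denominators: if a_n / b_n is
    nondecreasing, then so is the quotient of the two sums. *)
Lemma PSeries_cross_le (a b : nat -> R) (x y : R) :
  0 <= x <= y ->
  Rbar_lt (Rabs y) (CV_radius a) -> Rbar_lt (Rabs y) (CV_radius b) ->
  (forall m n, (n <= m)%nat -> a n * b m <= a m * b n) ->
  PSeries a x * PSeries b y <= PSeries a y * PSeries b x.
Proof.
  intros Hxy Hya Hyb Hab.
  assert (Habs : Rabs x <= Rabs y) by (rewrite !Rabs_pos_eq; lra).
  assert (Hlim : forall (d : nat -> R) z, Rabs z <= Rabs y ->
    Rbar_lt (Rabs y) (CV_radius d) ->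
    is_lim_seq (fun N => sum_f_R0 (fun n => d n * z ^ n) N) (PSeries d z)).
  { intros d z Hz Hd.
    assert (Hs : is_series (fun n => d n * z ^ n) (PSeries d z)).
    { apply is_pseries_R, PSeries_correct, CV_radius_inside.
      eapply Rbar_le_lt_trans; [|exact Hd]; exact Hz. }
    unfold is_series in Hs.
    eapply is_lim_seq_ext; [|exact Hs].
    intros n; apply sum_n_Reals. }
  eapply (is_lim_seq_le _ _ (Finite (PSeries a x * PSeries b y))
    (Finite (PSeries a y * PSeries b x))
    (fun N => partial_sums_cross_le a b x y N Hxy Hab)).
  - now apply is_lim_seq_mult'; apply Hlim; try lra.
  - now apply is_lim_seq_mult'; apply Hlim; try lra.
Qed.

(** * Positivity of the beta function *)

(** Integrals of a nonnegative function over [s,t] grow as the interval does,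
    so boundedness alone makes them converge to their supremum. *)
Lemma is_RInt_gen_nonneg_bounded (f : R -> R) (M : R) :
  (forall t, 0 < t -> continuous f t) ->
  (forall t, 0 < t -> 0 <= f t) ->
  (forall s t, 0 < s <= 1 -> 1 <= t -> RInt f s t <= M) ->
  exists L, is_RInt_gen f (at_right 0) (Rbar_locally p_infty) L /\
    forall s t, 0 < s <= 1 -> 1 <= t -> RInt f s t <= L.
Proof.
  intros Hcont Hpos HM.
  set (E := fun v => exists s t, (0 < s <= 1 /\ 1 <= t) /\ v = RInt f s t).
  destruct (completeness E) as [L [Lub Lleast]].
  { exists M; intros v (s & t & [Hs Ht] & ->); now apply HM. }
  { exists (RInt f 1 1), 1, 1; split; [lra | easy]. }
  assert (HL : forall s t, 0 < s <= 1 -> 1 <= t -> RInt f s t <= L).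
  { intros s t Hs Ht; apply Lub; now exists s, t. }
  exists L; split; [|exact HL].
  assert (Hex : forall s t, 0 < s -> s <= t -> ex_RInt f s t).
  { intros s t Hs Hst; apply (ex_RInt_continuous (V := R_CompleteNormedModule)).
    rewrite Rmin_left, Rmax_right by lra.
    intros z Hz; apply Hcont; lra. }
  assert (Hmono : forall s s0 t0 t, 0 < s <= s0 -> s0 <= t0 -> t0 <= t ->
    RInt f s0 t0 <= RInt f s t).
  { intros s s0 t0 t Hs Hst Ht.
    rewrite <- (RInt_Chasles f s s0 t) by (apply Hex; lra).
    rewrite <- (RInt_Chasles f s0 t0 t) by (apply Hex; lra).
    assert (0 <= RInt f s s0).
    { apply RInt_ge_0; [lra | apply Hex; lra | intros; apply Hpos; lra]. }
    assert (0 <= RInt f t0 t).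
    { apply RInt_ge_0; [lra | apply Hex; lra | intros; apply Hpos; lra]. }
    unfold plus; simpl; lra. }
  intros P [eps HP].
  assert (Hnear : exists s0 t0, (0 < s0 <= 1 /\ 1 <= t0) /\
    L - eps < RInt f s0 t0).
  { apply Classical_Prop.NNPP; intros Hno.
    assert (L <= L - eps); [|destruct eps; simpl in *; lra].
    apply Lleast; intros v (s & t & Hst & ->).
    apply Rnot_lt_le; intros Hlt; apply Hno; now exists s, t. }
  destruct Hnear as (s0 & t0 & [Hs0 Ht0] & Hlt).
  apply (Filter_prod _ _ _ (fun s => 0 < s < s0) (fun t => t0 < t)).
  - exists (mkposreal s0 (proj1 Hs0)); intros s Hball Hs.
    unfold ball in Hball; simpl in Hball.
    unfold AbsRing_ball, abs, minus, plus, opp in Hball; simpl in Hball.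
    rewrite Rabs_pos_eq in Hball by lra; lra.
  - now exists t0.
  - intros s t Hs Ht; exists (RInt f s t); split.
    + apply (RInt_correct f), Hex; lra.
    + apply HP.
      unfold ball; simpl; unfold AbsRing_ball, abs, minus, plus, opp; simpl.
      assert (Hup := HL s t ltac:(lra) ltac:(lra)).
      assert (Hlo := Hmono s s0 t0 t ltac:(lra) ltac:(lra) ltac:(lra)).
      apply Rabs_def1; destruct eps; simpl in *; lra.
Qed.

Lemma exp_le_compat (x y : R) : x <= y -> exp x <= exp y.
Proof.
  intros [Hlt | ->]; [now left; apply exp_increasing | apply Rle_refl].
Qed.

Lemma continuous_Gamma_integrand (x t : R) :
  0 < t -> continuous (fun t => Rpower t (x - 1) * exp (- t)) t.
Proof.
  intros Ht; unfold Rpower.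
  apply (ex_derive_continuous (V := R_NormedModule)); auto_derive; lra.
Qed.

Lemma Gamma_integral_near_0 (x s : R) :
  0 < x -> 0 < s <= 1 ->
  RInt (fun t => Rpower t (x - 1) * exp (- t)) s 1 <= / x.
Proof.
  intros Hx Hs.
  assert (Hprim : is_RInt (fun t => Rpower t (x - 1)) s 1
    (Rpower 1 x / x - Rpower s x / x)).
  { apply (is_RInt_derive (V := R_CompleteNormedModule) 
             (fun t => Rpower t x / x)
             (fun t => Rpower t (x - 1)));
      rewrite Rmin_left, Rmax_right by lra; intros t Ht.
    - evar_last.
      { apply (is_derive_ext (fun t => / x * Rpower t x));
          [intros u; apply Rmult_comm |].
        apply is_derive_scal, is_derive_Reals, derivable_pt_lim_power; lra. }
      simpl; field; lra.
    - apply (ex_derive_continuous (V := R_NormedModule)).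
      unfold Rpower; auto_derive; lra. }
  apply Rle_trans with (RInt (fun t => Rpower t (x - 1)) s 1).
  - apply RInt_le; [lra | | now eexists; apply Hprim |].
    + apply (ex_RInt_continuous (V := R_CompleteNormedModule)).
      rewrite Rmin_left, Rmax_right by lra.
      intros t Ht; apply continuous_Gamma_integrand; lra.
    + intros t Ht.
      assert (exp (- t) <= 1) by (rewrite <- exp_0; apply exp_le_compat; lra).
      assert (0 < Rpower t (x - 1)) by apply exp_pos.
      nra.
  - rewrite (is_RInt_unique _ _ _ _ Hprim).
    replace (Rpower 1 x) with 1
      by (unfold Rpower; rewrite ln_1, Rmult_0_r, exp_0; easy).
    assert (0 < Rpower s x / x)
      by (apply Rdiv_lt_0_compat; [apply exp_pos | lra]).
    lra.
Qed.

(** From e^v >= v at v = u/(x+1) one gets e^u >= (u/(x+1))^(x+1), hence the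
    integrand is at most (x+1)^(x+1) / u^2. *)
Lemma Gamma_integral_near_infty (x t : R) :
  0 < x -> 1 <= t ->
  RInt (fun u => Rpower u (x - 1) * exp (- u)) 1 t <= Rpower (x + 1) (x + 1).
Proof.
  intros Hx Ht.
  set (C := Rpower (x + 1) (x + 1)).
  assert (HC : 0 < C) by apply exp_pos.
  assert (Hprim : is_RInt (fun u => C / u ^ 2) 1 t (- C / t - - C / 1)).
  { apply (is_RInt_derive (V := R_CompleteNormedModule) (fun u => - C / u)
             (fun u => C / u ^ 2));
      rewrite Rmin_left, Rmax_right by lra; intros u Hu.
    - auto_derive; [lra | field; lra].
    - apply (ex_derive_continuous (V := R_NormedModule)).
      auto_derive; nra. }
  apply Rle_trans with (RInt (fun u => C / u ^ 2) 1 t).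
  - apply RInt_le; [lra | | now eexists; apply Hprim |].
    + apply (ex_RInt_continuous (V := R_CompleteNormedModule)).
      rewrite Rmin_left, Rmax_right by lra.
      intros u Hu; apply continuous_Gamma_integrand; lra.
    + intros u Hu.
      assert (Hln : ln u - ln (x + 1) <= u / (x + 1)).
      { rewrite <- ln_div by lra.
        apply Rlt_le, exp_lt_inv; rewrite exp_ln
          by (apply Rdiv_lt_0_compat; lra).
        assert (0 < u / (x + 1)) by (apply Rdiv_lt_0_compat; lra).
        assert (Hexp := exp_ineq1 (u / (x + 1)) ltac:(lra)); lra. }
      assert (Hln' : (x + 1) * ln u <= u + (x + 1) * ln (x + 1)).
      { apply (Rmult_le_compat_l (x + 1)) in Hln; [|lra].
        replace ((x + 1) * (u / (x + 1))) with u in Hln by (field; lra).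
        lra. }
      replace (C / u ^ 2) with (exp ((x + 1) * ln (x + 1) - 2 * ln u)).
      * unfold Rpower; rewrite <- exp_plus; apply exp_le_compat; lra.
      * unfold Rminus; rewrite exp_plus, exp_Ropp.
        replace (2 * ln u) with (ln u + ln u) by ring.
        rewrite exp_plus, exp_ln by lra.
        unfold C, Rpower; field; lra.
  - rewrite (is_RInt_unique _ _ _ _ Hprim).
    assert (0 < C / t) by (apply Rdiv_lt_0_compat; lra).
    unfold Rdiv in *; lra.
Qed.

Lemma Gamma_pos (x : R) : 0 < x -> 0 < Gamma x.
Proof.
  intros Hx.
  set (f := fun t => Rpower t (x - 1) * exp (- t)).
  assert (Hpos : forall t, 0 < f t)
    by (intros t; apply Rmult_lt_0_compat; apply exp_pos).
  destruct (is_RInt_gen_nonneg_bounded f (/ x + Rpower (x + 1) (x + 1)))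
    as [L [HL Hle]].
  - intros t Ht; now apply continuous_Gamma_integrand.
  - intros t _; now apply Rlt_le.
  - intros s t Hs Ht.
    rewrite <- (RInt_Chasles f s 1 t).
    + assert (H0 := Gamma_integral_near_0 x s Hx Hs).
      assert (H1 := Gamma_integral_near_infty x t Hx Ht).
      unfold plus; simpl; unfold f; lra.
    + apply (ex_RInt_continuous (V := R_CompleteNormedModule)).
      rewrite Rmin_left, Rmax_right by lra.
      intros u Hu; apply continuous_Gamma_integrand; lra.
    + apply (ex_RInt_continuous (V := R_CompleteNormedModule)).
      rewrite Rmin_left, Rmax_right by lra.
      intros u Hu; apply continuous_Gamma_integrand; lra.
  - unfold Gamma; fold f.
    rewrite (is_RInt_gen_unique f L HL).
    apply Rlt_le_trans with (RInt f 1 2); [|apply Hle; lra].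
    apply RInt_gt_0; [lra | intros; apply Hpos |].
    intros u Hu; apply continuous_Gamma_integrand; lra.
Qed.

Lemma Beta_pos (x y : R) : 0 < x -> 0 < y -> 0 < Beta x y.
Proof.
  intros Hx Hy; unfold Beta.
  apply Rdiv_lt_0_compat; [apply Rmult_lt_0_compat |]; apply Gamma_pos; lra.
Qed.

(** * The zero-balanced hypergeometric series *)

Definition zb_coef (a b : R) (n : nat) : R :=
  pochhammer a n * pochhammer b n / (pochhammer (a + b) n * INR (fact n)).

(** The coefficients of (1-u) F'(u), see [zbK_derive]. *)
Definition zbK_coef (a b : R) (n : nat) : R :=
  a * b / (a + b + INR n) * zb_coef a b n.

Definition zbF (a b u : R) : R := PSeries (zb_coef a b) u.

Definition zbK (a b u : R) : R := PSeries (zbK_coef a b) u.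

Lemma pochhammer_pos (a : R) (n : nat) : 0 < a -> 0 < pochhammer a n.
Proof.
  intros Ha; induction n as [|n IH]; simpl; [lra |].
  apply Rmult_lt_0_compat; [easy |].
  assert (Hn := pos_INR n); lra.
Qed.

Lemma zb_coef_pos (a b : R) (n : nat) : 0 < a -> 0 < b -> 0 < zb_coef a b n.
Proof.
  intros Ha Hb; unfold zb_coef.
  assert (Hf := INR_fact_lt_0 n).
  apply Rdiv_lt_0_compat; apply Rmult_lt_0_compat; try easy;
    apply pochhammer_pos; lra.
Qed.

Lemma zb_coef_0 (a b : R) : zb_coef a b 0 = 1.
Proof. unfold zb_coef; simpl; field. Qed.

Lemma zb_coef_S (a b : R) (n : nat) : 0 < a -> 0 < b ->
  INR (S n) * zb_coef a b (S n) =
  (a + INR n) * (b + INR n) / (a + b + INR n) * zb_coef a b n.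
Proof.
  intros Ha Hb; unfold zb_coef.
  rewrite fact_simpl, mult_INR; simpl pochhammer.
  assert (Hf := INR_fact_lt_0 n).
  assert (Hc := pochhammer_pos (a + b) n ltac:(lra)).
  assert (Hn := pos_INR n).
  rewrite S_INR; field; lra.
Qed.

Lemma zbK_coef_pos (a b : R) (n : nat) :
  0 < a -> 0 < b -> 0 < zbK_coef a b n.
Proof.
  intros Ha Hb; unfold zbK_coef.
  assert (Hn := pos_INR n).
  apply Rmult_lt_0_compat; [|now apply zb_coef_pos].
  apply Rdiv_lt_0_compat; nra.
Qed.

(** Where c = a+b is used: (a+n)(b+n) - n(c+n) = ab. *)
Lemma zbK_coef_recurrence (a b : R) (n : nat) : 0 < a -> 0 < b ->
  zbK_coef a b n = INR (S n) * zb_coef a b (S n) - INR n * zb_coef a b n.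
Proof.
  intros Ha Hb; rewrite zb_coef_S by easy; unfold zbK_coef.
  assert (Hn := pos_INR n).
  field; lra.
Qed.

(** The quotient of consecutive coefficients is (a+n)(b+n)/((c+n)(1+n)), which
    is at most 1 when ab <= c. A bound on the coefficients is all that the
    radius of convergence needs. *)
Lemma zb_coef_le_1 (a b : R) (n : nat) :
  0 < a -> 0 < b -> a + b <= 1 -> zb_coef a b n <= 1.
Proof.
  intros Ha Hb Hab; induction n as [|n IH]; [rewrite zb_coef_0; lra |].
  assert (Hn := pos_INR n).
  assert (Hpos := zb_coef_pos a b n Ha Hb).
  apply (Rmult_le_reg_l (INR (S n))); [rewrite S_INR; lra |].
  rewrite zb_coef_S by easy.
  apply Rle_trans with (INR (S n) * zb_coef a b n);
    [|rewrite S_INR; nra].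
  apply Rmult_le_compat_r; [lra |].
  apply Rle_div_l; [lra |].
  rewrite S_INR; nra.
Qed.

Lemma CV_radius_ge_1 (d : nat -> R) :
  (forall n, Rabs (d n) <= 1) -> Rbar_le 1 (CV_radius d).
Proof.
  intros Hd; apply (CV_radius_bounded d).
  exists 1; intros n; rewrite pow1, Rmult_1_r; apply Hd.
Qed.

Lemma CV_disk_zb (a b u : R) : 0 < a -> 0 < b -> a + b <= 1 ->
  Rabs u < 1 -> Rbar_lt (Rabs u) (CV_radius (zb_coef a b)).
Proof.
  intros Ha Hb Hab Hu.
  apply Rbar_lt_le_trans with 1; [easy |].
  apply CV_radius_ge_1; intros n.
  rewrite Rabs_pos_eq by now apply Rlt_le, zb_coef_pos.
  now apply zb_coef_le_1.
Qed.

Lemma CV_disk_zbK (a b u : R) : 0 < a -> 0 < b -> a + b <= 1 ->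
  Rabs u < 1 -> Rbar_lt (Rabs u) (CV_radius (zbK_coef a b)).
Proof.
  intros Ha Hb Hab Hu.
  apply Rbar_lt_le_trans with 1; [easy |].
  apply CV_radius_ge_1; intros n.
  rewrite Rabs_pos_eq by now apply Rlt_le, zbK_coef_pos.
  unfold zbK_coef.
  assert (Hn := pos_INR n).
  assert (Hpos := zb_coef_pos a b n Ha Hb).
  assert (Hle := zb_coef_le_1 a b n Ha Hb Hab).
  assert (0 < a * b / (a + b + INR n)) by (apply Rdiv_lt_0_compat; nra).
  assert (a * b / (a + b + INR n) <= 1) by (apply Rle_div_l; nra).
  nra.
Qed.

(** The Euler operator u d/du multiplies the n-th coefficient by n. *)
Lemma PSeries_euler (d : nat -> R) (u : R) :
  PSeries (fun n => INR n * d n) u = u * PSeries (PS_derive d) u.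
Proof.
  rewrite <- PSeries_incr_1; apply PSeries_ext.
  intros [|n]; [simpl; unfold zero; simpl; ring | easy].
Qed.

Lemma zbK_derive (a b u : R) : 0 < a -> 0 < b -> a + b <= 1 -> Rabs u < 1 ->
  zbK a b u = (1 - u) * PSeries (PS_derive (zb_coef a b)) u.
Proof.
  intros Ha Hb Hab Hu.
  assert (Hd : ex_pseries (PS_derive (zb_coef a b)) u)
    by now apply ex_pseries_derive, CV_disk_zb.
  replace ((1 - u) * PSeries (PS_derive (zb_coef a b)) u)
    with (PSeries (PS_derive (zb_coef a b)) u
          - u * PSeries (PS_derive (zb_coef a b)) u) by ring.
  rewrite <- PSeries_incr_1, <- PSeries_minus;
    [|easy | now apply ex_pseries_incr_1].
  apply PSeries_ext; intros n.
  rewrite zbK_coef_recurrence by easy.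
  unfold PS_minus, PS_plus, PS_opp, PS_incr_1, PS_derive, plus, opp; simpl.
  destruct n as [|n]; unfold zero; simpl; ring.
Qed.

Lemma is_derive_zbF (a b u : R) : 0 < a -> 0 < b -> a + b <= 1 ->
  Rabs u < 1 -> is_derive (zbF a b) u (zbK a b u / (1 - u)).
Proof.
  intros Ha Hb Hab Hu.
  assert (u < 1) by (apply Rle_lt_trans with (Rabs u); [apply Rle_abs | easy]).
  rewrite zbK_derive by easy.
  replace (_ / (1 - u)) with (PSeries (PS_derive (zb_coef a b)) u)
    by (field; lra).
  now apply is_derive_PSeries, CV_disk_zb.
Qed.

(** The Euler operator u d/du turns the factor ab/(c+n) of the coefficients of K
    into n ab/(c+n) = ab - c ab/(c+n). *)
Lemma is_derive_zbK (a b u : R) : 0 < a -> 0 < b -> a + b <= 1 ->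
  0 < u < 1 ->
  is_derive (zbK a b) u ((a * b * zbF a b u - (a + b) * zbK a b u) / u).
Proof.
  intros Ha Hb Hab Hu.
  assert (Hu' : Rabs u < 1) by (rewrite Rabs_pos_eq; lra).
  replace (_ / u) with (PSeries (PS_derive (zbK_coef a b)) u).
  { now apply is_derive_PSeries, CV_disk_zbK. }
  apply (Rmult_eq_reg_l u); [|lra].
  replace (u * (_ / u)) with (a * b * zbF a b u - (a + b) * zbK a b u)
    by (field; lra).
  unfold zbF, zbK; rewrite <- PSeries_euler, <- !PSeries_scal, <- PSeries_minus;
    [| apply ex_pseries_scal; [apply Rmult_comm |];
       now apply CV_radius_inside, CV_disk_zb
     | apply ex_pseries_scal; [apply Rmult_comm |];
       now apply CV_radius_inside, CV_disk_zbK].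
  apply PSeries_ext; intros n.
  unfold PS_minus, PS_plus, PS_opp, PS_scal, plus, opp, scal; simpl.
  unfold mult; simpl; unfold zbK_coef.
  assert (Hn := pos_INR n).
  field; lra.
Qed.

Lemma zbF_ge_1 (a b u : R) : 0 < a -> 0 < b -> a + b <= 1 -> 0 <= u < 1 ->
  1 <= zbF a b u.
Proof.
  intros Ha Hb Hab Hu.
  assert (H : zb_coef a b 0 + zb_coef a b 1 * u <= zbF a b u).
  { apply PSeries_ge_affine; [easy | |].
    - apply CV_disk_zb; try easy; rewrite Rabs_pos_eq; lra.
    - intros n; now apply Rlt_le, zb_coef_pos. }
  rewrite zb_coef_0 in H.
  assert (H1 := zb_coef_pos a b 1 Ha Hb); nra.
Qed.

Lemma zbK_ge (a b u : R) : 0 < a -> 0 < b -> a + b <= 1 -> 0 <= u < 1 ->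
  a * b / (a + b) <= zbK a b u.
Proof.
  intros Ha Hb Hab Hu.
  assert (H : zbK_coef a b 0 + zbK_coef a b 1 * u <= zbK a b u).
  { apply PSeries_ge_affine; [easy | |].
    - apply CV_disk_zbK; try easy; rewrite Rabs_pos_eq; lra.
    - intros n; now apply Rlt_le, zbK_coef_pos. }
  assert (H1 := zbK_coef_pos a b 1 Ha Hb).
  unfold zbK_coef at 1 in H; rewrite zb_coef_0 in H; simpl in H.
  rewrite Rplus_0_r, Rmult_1_r in H; nra.
Qed.

Lemma zbK_pos (a b u : R) : 0 < a -> 0 < b -> a + b <= 1 -> 0 <= u < 1 ->
  0 < zbK a b u.
Proof.
  intros Ha Hb Hab Hu.
  apply Rlt_le_trans with (a * b / (a + b)); [|now apply zbK_ge].
  apply Rdiv_lt_0_compat; nra.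
Qed.

(** Termwise ab/(c+n) <= ab/c <= c/4, the last step by the arithmetic-geometric
    mean inequality. Strictness comes from the linear coefficient; it is what
    makes the final concavity strict even when a = b = 1/2. *)
Lemma zbK_lt_zbF (a b u : R) : 0 < a -> 0 < b -> a + b <= 1 -> 0 < u < 1 ->
  zbK a b u < (a + b) / 4 * zbF a b u.
Proof.
  intros Ha Hb Hab Hu.
  assert (Hu' : Rabs u < 1) by (rewrite Rabs_pos_eq; lra).
  assert (HcvF := CV_disk_zb a b u Ha Hb Hab Hu').
  assert (HcvK := CV_disk_zbK a b u Ha Hb Hab Hu').
  assert (HF := zbF_ge_1 a b u Ha Hb Hab ltac:(lra)).
  apply Rlt_le_trans with (a * b / (a + b) * zbF a b u).
  - (* ab/c F - K has the nonnegative coefficients ab (1/c - 1/(c+n)) a_n *)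
    set (d := PS_minus (PS_scal (a * b / (a + b)) (zb_coef a b))
                       (zbK_coef a b)).
    assert (Hd : forall n, d n = a * b * INR n / ((a + b) * (a + b + INR n))
                                 * zb_coef a b n).
    { intros n; unfold d, PS_minus, PS_plus, PS_opp, PS_scal, plus, opp, scal.
      simpl; unfold mult; simpl; unfold zbK_coef.
      assert (Hn := pos_INR n); field; lra. }
    assert (Hge : d 0%nat + d 1%nat * u <= PSeries d u).
    { apply PSeries_ge_affine; [lra | |].
      - eapply Rbar_lt_le_trans; 
          [|apply (CV_radius_plus _ (PS_opp (zbK_coef a b)))].
        rewrite CV_radius_opp; apply Rbar_min_case; [|easy].
        rewrite CV_radius_scal; [easy |].
        apply Rgt_not_eq, Rdiv_lt_0_compat; nra.
      - intros n; rewrite Hd.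
        assert (Hn := pos_INR n).
        assert (Hp := zb_coef_pos a b n Ha Hb).
        apply Rmult_le_pos; [|lra].
        apply Rmult_le_pos; [|apply Rlt_le, Rinv_0_lt_compat; nra].
        apply Rmult_le_pos; [nra | lra]. }
    assert (H1 : 0 < d 1%nat).
    { rewrite Hd; apply Rmult_lt_0_compat; [|now apply zb_coef_pos].
      simpl; apply Rdiv_lt_0_compat; nra. }
    assert (H0 : d 0%nat = 0) by (rewrite Hd; simpl; field; lra).
    unfold d in Hge at 3; rewrite PSeries_minus, PSeries_scal in Hge;
      [| apply ex_pseries_scal; [apply Rmult_comm |]; now apply CV_radius_inside
       | now apply CV_radius_inside].
    fold (zbF a b u) (zbK a b u) in Hge; nra.
  - apply Rmult_le_compat_r; [lra |].
    apply Rle_div_l; [lra |].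
    assert (0 <= (a - b) ^ 2) by apply pow2_ge_0; nra.
Qed.

Lemma zbK_div_zbF_decreasing (a b u v : R) : 0 < a -> 0 < b -> a + b <= 1 ->
  0 <= u <= v -> v < 1 ->
  zbF a b u * zbK a b v <= zbK a b u * zbF a b v.
Proof.
  intros Ha Hb Hab Huv Hv.
  assert (Hv' : Rabs v < 1) by (rewrite Rabs_pos_eq; lra).
  rewrite (Rmult_comm (zbK a b u)).
  apply PSeries_cross_le; [easy | now apply CV_disk_zb |
    now apply CV_disk_zbK |].
  intros m n Hnm; unfold zbK_coef.
  apply le_INR in Hnm; assert (Hn := pos_INR n).
  assert (Hpm := zb_coef_pos a b m Ha Hb).
  assert (Hpn := zb_coef_pos a b n Ha Hb).
  assert (a * b / (a + b + INR m) <= a * b / (a + b + INR n)).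
  { apply Rmult_le_compat_l; [nra | apply Rinv_le_contravar; lra]. }
  assert (0 < zb_coef a b m * zb_coef a b n) by now apply Rmult_lt_0_compat.
  nra.
Qed.

(** Monotonicity of F'/F, with F' written as K/(1-u). *)
Lemma zbF_log_convex (a b u v : R) : 0 < a -> 0 < b -> a + b <= 1 ->
  0 <= u <= v -> v < 1 ->
  (1 - v) * (zbK a b u * zbF a b v) <= (1 - u) * (zbF a b u * zbK a b v).
Proof.
  intros Ha Hb Hab Huv Hv.
  assert (Hu' : Rabs u < 1) by (rewrite Rabs_pos_eq; lra).
  assert (Hv' : Rabs v < 1) by (rewrite Rabs_pos_eq; lra).
  rewrite !zbK_derive by easy.
  assert (H : PSeries (PS_derive (zb_coef a b)) u * zbF a b v <=
              PSeries (PS_derive (zb_coef a b)) v * zbF a b u).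
  { apply PSeries_cross_le; [easy | | now apply CV_disk_zb |].
    { rewrite CV_radius_derive; now apply CV_disk_zb. }
    intros m n Hnm; unfold PS_derive; rewrite !zb_coef_S by easy.
    apply le_INR in Hnm; assert (Hn := pos_INR n).
    assert (Hpm := zb_coef_pos a b m Ha Hb).
    assert (Hpn := zb_coef_pos a b n Ha Hb).
    (* the quotient (k+1) a_(k+1) / a_k is k + ab/(c+k), and ab <= c^2 *)
    assert ((a + INR n) * (b + INR n) / (a + b + INR n) <=
            (a + INR m) * (b + INR m) / (a + b + INR m)).
    { apply Rminus_le_0.
      replace (_ - _) with ((INR m - INR n) *
          ((a + b + INR m) * (a + b + INR n) - a * b)
          / ((a + b + INR m) * (a + b + INR n))) by (field; lra).
      assert (0 <= (a + b) * (INR m + INR n)) by nra.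
      assert (0 <= INR m * INR n) by nra.
      assert (0 < a * b) by nra.
      apply Rmult_le_pos; [|apply Rlt_le, Rinv_0_lt_compat; nra].
      apply Rmult_le_pos; [lra | nra]. }
    assert (0 < zb_coef a b m * zb_coef a b n) by now apply Rmult_lt_0_compat.
    nra. }
  assert (0 < (1 - u) * (1 - v)) by nra.
  nra.
Qed.

(** Integrate F' = K/(1-t) >= (ab/c)/(1-t). *)
Lemma zbF_ge_log (a b u : R) : 0 < a -> 0 < b -> a + b <= 1 -> 0 <= u < 1 ->
  1 - a * b / (a + b) * ln (1 - u) <= zbF a b u.
Proof.
  intros Ha Hb Hab Hu.
  destruct (Req_dec u 0) as [-> | Hu0].
  { rewrite Rminus_0_r, ln_1.
    assert (H := zbF_ge_1 a b 0 Ha Hb Hab ltac:(lra)); lra. }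
  set (k := a * b / (a + b)).
  destruct (MVT_cor2 (fun t => zbF a b t + k * ln (1 - t))
    (fun t => zbK a b t / (1 - t) - k / (1 - t)) 0 u) as (t & Heq & Ht);
    [lra | |].
  - intros t Ht; apply is_derive_Reals.
    apply (is_derive_plus (V := R_NormedModule) _ (fun t => k * ln (1 - t))
             t _ (- (k / (1 - t)))).
    + apply is_derive_zbF; try easy; rewrite Rabs_pos_eq; lra.
    + auto_derive; [lra | field; lra].
  - rewrite Rminus_0_r, ln_1 in Heq.
    assert (HK := zbK_ge a b t Ha Hb Hab ltac:(lra)); fold k in HK.
    assert (H1 := zbF_ge_1 a b 0 Ha Hb Hab ltac:(lra)).
    assert (0 <= (zbK a b t / (1 - t) - k / (1 - t)) * (u - 0)).
    { apply Rmult_le_pos; [|lra].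
      unfold Rdiv; rewrite <- Rmult_minus_distr_r.
      apply Rmult_le_pos; [lra | apply Rlt_le, Rinv_0_lt_compat; lra]. }
    lra.
Qed.

(** * Monotonicity of the slope *)

Definition zb_ratio (a b u : R) : R := zbF a b (1 - u) / zbF a b u.

(** This is u(1-u) (F'(u) F(1-u) + F(u) F'(1-u)): up to the factor u(1-u), the
    Wronskian of F(1-u) and F(u). It is constant in the classical case
    a + b = 1. *)
Definition zb_wronskian (a b u : R) : R :=
  u * (zbK a b u * zbF a b (1 - u)) + (1 - u) * (zbF a b u * zbK a b (1 - u)).

(** The derivative of x |-> mu_{a,c}(1/cosh x) at u = 1/cosh(x)^2, without its
    beta factor, see [is_derive_mu_sech]. *)
Definition zb_slope (a b u : R) : R :=
  zb_wronskian a b u / (sqrt (1 - u) * zbF a b u ^ 2).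

Lemma zb_wronskian_pos (a b u : R) : 0 < a -> 0 < b -> a + b <= 1 ->
  0 < u < 1 -> 0 < zb_wronskian a b u.
Proof.
  intros Ha Hb Hab Hu; unfold zb_wronskian.
  assert (H1 := zbK_pos a b u Ha Hb Hab ltac:(lra)).
  assert (H2 := zbK_pos a b (1 - u) Ha Hb Hab ltac:(lra)).
  assert (H3 := zbF_ge_1 a b u Ha Hb Hab ltac:(lra)).
  assert (H4 := zbF_ge_1 a b (1 - u) Ha Hb Hab ltac:(lra)).
  apply Rplus_lt_0_compat; repeat apply Rmult_lt_0_compat; lra.
Qed.

Lemma zb_slope_pos (a b u : R) : 0 < a -> 0 < b -> a + b <= 1 ->
  0 < u < 1 -> 0 < zb_slope a b u.
Proof.
  intros Ha Hb Hab Hu; unfold zb_slope.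
  assert (HF := zbF_ge_1 a b u Ha Hb Hab ltac:(lra)).
  apply Rdiv_lt_0_compat; [now apply zb_wronskian_pos |].
  apply Rmult_lt_0_compat; [apply sqrt_lt_R0; lra | apply pow_lt; lra].
Qed.

Lemma is_derive_reflect (f : R -> R) (u l : R) :
  is_derive f (1 - u) l -> is_derive (fun t => f (1 - t)) u (- l).
Proof.
  intros Hf; evar_last.
  - apply (is_derive_comp (V := R_NormedModule) f (fun t => 1 - t)); [exact Hf |].
    auto_derive; [easy | reflexivity].
  - unfold scal; simpl; unfold mult; simpl; ring.
Qed.

Lemma is_derive_zbF_reflect (a b u : R) : 0 < a -> 0 < b -> a + b <= 1 ->
  0 < u < 1 ->
  is_derive (fun t => zbF a b (1 - t)) u (- (zbK a b (1 - u) / u)).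
Proof.
  intros Ha Hb Hab Hu; apply is_derive_reflect.
  replace (zbK a b (1 - u) / u) with (zbK a b (1 - u) / (1 - (1 - u)))
    by (f_equal; ring).
  apply is_derive_zbF; try easy; rewrite Rabs_pos_eq; lra.
Qed.

Lemma is_derive_zbK_reflect (a b u : R) : 0 < a -> 0 < b -> a + b <= 1 ->
  0 < u < 1 ->
  is_derive (fun t => zbK a b (1 - t)) u
    (- ((a * b * zbF a b (1 - u) - (a + b) * zbK a b (1 - u)) / (1 - u))).
Proof.
  intros Ha Hb Hab Hu; apply is_derive_reflect, is_derive_zbK; lra.
Qed.

Lemma is_derive_zb_ratio (a b u : R) : 0 < a -> 0 < b -> a + b <= 1 ->
  0 < u < 1 ->
  is_derive (zb_ratio a b) u
    (- (zb_wronskian a b u / (u * (1 - u) * zbF a b u ^ 2))).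
Proof.
  intros Ha Hb Hab Hu.
  assert (HF := zbF_ge_1 a b u Ha Hb Hab ltac:(lra)).
  evar_last.
  - apply is_derive_div.
    + now apply is_derive_zbF_reflect.
    + apply is_derive_zbF; try easy; rewrite Rabs_pos_eq; lra.
    + lra.
  - unfold zb_wronskian; field; lra.
Qed.

(** The terms K(u)K(1-u) and ab F(u)F(1-u) cancel between the two summands. *)
Lemma is_derive_zb_wronskian (a b u : R) : 0 < a -> 0 < b -> a + b <= 1 ->
  0 < u < 1 ->
  is_derive (zb_wronskian a b) u
    ((1 - (a + b)) *
     (zbK a b u * zbF a b (1 - u) - zbF a b u * zbK a b (1 - u))).
Proof.
  intros Ha Hb Hab Hu.
  assert (HF : is_derive (zbF a b) u (zbK a b u / (1 - u)))
    by (apply is_derive_zbF; try easy; rewrite Rabs_pos_eq; lra).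
  assert (HK := is_derive_zbK a b u Ha Hb Hab Hu).
  assert (HFr := is_derive_zbF_reflect a b u Ha Hb Hab Hu).
  assert (HKr := is_derive_zbK_reflect a b u Ha Hb Hab Hu).
  unfold zb_wronskian; evar_last.
  - apply (is_derive_plus (V := R_NormedModule)
             (fun t => t * (zbK a b t * zbF a b (1 - t)))
             (fun t => (1 - t) * (zbF a b t * zbK a b (1 - t)))).
    + apply (is_derive_mult (fun t => t)
               (fun t => zbK a b t * zbF a b (1 - t)));
        [apply is_derive_id | | apply Rmult_comm].
      apply (is_derive_mult (zbK a b) (fun t => zbF a b (1 - t)));
        [exact HK | exact HFr | apply Rmult_comm].
    + apply (is_derive_mult (fun t => 1 - t)
               (fun t => zbF a b t * zbK a b (1 - t)));
        [| | apply Rmult_comm].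
      * apply (is_derive_reflect (fun t => t)), is_derive_id.
      * apply (is_derive_mult (zbF a b) (fun t => zbK a b (1 - t)));
          [exact HF | exact HKr | apply Rmult_comm].
  - unfold plus, mult, one; simpl; unfold mult; simpl; field; lra.
Qed.

(** The summand 1/2 stems from the factor 1/sqrt(1-u). *)
Lemma is_derive_zb_slope (a b u : R) : 0 < a -> 0 < b -> a + b <= 1 ->
  0 < u < 1 ->
  is_derive (zb_slope a b) u
    (((1 - (a + b)) * (1 - u) *
        (zbK a b u * zbF a b (1 - u) - zbF a b u * zbK a b (1 - u))
      + zb_wronskian a b u * (1 / 2 - 2 * (zbK a b u / zbF a b u)))
     / ((1 - u) * sqrt (1 - u) * zbF a b u ^ 2)).
Proof.
  intros Ha Hb Hab Hu.
  assert (HF1 := zbF_ge_1 a b u Ha Hb Hab ltac:(lra)).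
  assert (Hsq : 0 < sqrt (1 - u)) by (apply sqrt_lt_R0; lra).
  assert (Hsqr : sqrt (1 - u) * sqrt (1 - u) = 1 - u)
    by (apply sqrt_sqrt; lra).
  assert (HF : is_derive (zbF a b) u (zbK a b u / (1 - u)))
    by (apply is_derive_zbF; try easy; rewrite Rabs_pos_eq; lra).
  unfold zb_slope; evar_last.
  - apply is_derive_div.
    + now apply is_derive_zb_wronskian.
    + apply (is_derive_mult (fun t => sqrt (1 - t)) (fun t => zbF a b t ^ 2));
        [| | apply Rmult_comm].
      * apply (is_derive_reflect sqrt), is_derive_Reals,
          derivable_pt_lim_sqrt; lra.
      * apply is_derive_pow; exact HF.
    + apply Rgt_not_eq, Rmult_lt_0_compat; [easy | apply pow_lt; lra].
  - unfold plus, mult; simpl; unfold mult; simpl.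
    set (s := sqrt (1 - u)) in *.
    (* with u = 1 - s^2 the identity is rational in s *)
    replace u with (1 - s * s) in * by lra.
    set (F := zbF a b (1 - s * s)) in *.
    set (W := zb_wronskian a b (1 - s * s)) in *.
    field.
    repeat split; nra.
Qed.

(** Since K/F < c/4, replacing 1/2 - 2K/F by (1-c)/2 loses a positive amount, so
    a nonnegative bound suffices for what is left. For u <= 1/2 this follows from
    K(u)/F(u) >= K(1-u)/F(1-u). For u >= 1/2 it reads
    (2-u) K(u)F(1-u) >= (1-u) F(u)K(1-u); the log-convexity of F gives it even
    with u in place of 2-u. *)
Lemma zb_slope_derivative_pos (a b u : R) : 0 < a -> 0 < b -> a + b <= 1 ->
  0 < u < 1 ->
  0 < (1 - (a + b)) * (1 - u) *
        (zbK a b u * zbF a b (1 - u) - zbF a b u * zbK a b (1 - u))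
      + zb_wronskian a b u * (1 / 2 - 2 * (zbK a b u / zbF a b u)).
Proof.
  intros Ha Hb Hab Hu.
  assert (HW := zb_wronskian_pos a b u Ha Hb Hab Hu).
  assert (HF := zbF_ge_1 a b u Ha Hb Hab ltac:(lra)).
  assert (HFr := zbF_ge_1 a b (1 - u) Ha Hb Hab ltac:(lra)).
  assert (HK := zbK_pos a b u Ha Hb Hab ltac:(lra)).
  assert (HKr := zbK_pos a b (1 - u) Ha Hb Hab ltac:(lra)).
  assert (Hphi : zbK a b u / zbF a b u < (a + b) / 4).
  { apply Rlt_div_l; [lra | now apply zbK_lt_zbF]. }
  set (phi := zbK a b u / zbF a b u) in *.
  assert (Hgain : 0 < zb_wronskian a b u *
                      (1 / 2 - 2 * phi - (1 - (a + b)) / 2))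
    by (apply Rmult_lt_0_compat; lra).
  destruct (Rle_dec u (1 / 2)) as [Hle | Hgt].
  - assert (H := zbK_div_zbF_decreasing a b u (1 - u) Ha Hb Hab
                   ltac:(lra) ltac:(lra)).
    assert (0 <= (1 - (a + b)) * (1 - u) *
      (zbK a b u * zbF a b (1 - u) - zbF a b u * zbK a b (1 - u)))
      by (repeat apply Rmult_le_pos; lra).
    assert (0 <= zb_wronskian a b u * ((1 - (a + b)) / 2))
      by (apply Rmult_le_pos; lra).
    lra.
  - assert (H := zbF_log_convex a b (1 - u) u Ha Hb Hab
                   ltac:(lra) ltac:(lra)).
    assert (Hsuff : 0 <= (1 - (a + b)) *
      ((1 - u) * (zbK a b u * zbF a b (1 - u) - zbF a b u * zbK a b (1 - u))
       + zb_wronskian a b u / 2)); [|lra].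
    apply Rmult_le_pos; [lra |].
    unfold zb_wronskian.
    assert (0 < zbK a b u * zbF a b (1 - u))
      by (apply Rmult_lt_0_compat; lra).
    nra.
Qed.

Lemma zb_slope_increasing (a b u v : R) : 0 < a -> 0 < b -> a + b <= 1 ->
  0 < u -> u < v -> v < 1 -> zb_slope a b u < zb_slope a b v.
Proof.
  intros Ha Hb Hab Hu Huv Hv.
  eapply (incr_function (zb_slope a b) 0 1);
    [| | exact Hu | exact Huv | exact Hv].
  - intros t Ht0 Ht1; apply is_derive_zb_slope; try easy; now split.
  - intros t Ht0 Ht1; simpl in Ht0, Ht1.
    assert (HF := zbF_ge_1 a b t Ha Hb Hab ltac:(lra)).
    apply Rlt_gt, Rdiv_lt_0_compat; [now apply zb_slope_derivative_pos |].
    repeat apply Rmult_lt_0_compat; try lra; apply sqrt_lt_R0; lra.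
Qed.

(** As u tends to 0 the numerator grows like -ln u, while the denominator stays
    below F(1/2). *)
Lemma zb_ratio_unbounded (a b M : R) : 0 < a -> 0 < b -> a + b <= 1 ->
  0 < M -> exists u, 0 < u < 1 /\ M < zb_ratio a b u.
Proof.
  intros Ha Hb Hab HM.
  set (k := a * b / (a + b)).
  assert (Hk : 0 < k) by (apply Rdiv_lt_0_compat; nra).
  set (C := zbF a b (1 / 2)).
  assert (HC : 1 <= C) by (apply zbF_ge_1; lra).
  (* u <= 1/2 keeps F(u) below C, and -k ln u >= M C makes F(1-u) exceed M C *)
  set (u := Rmin (1 / 2) (exp (- (M * C / k)))).
  assert (Hu0 : 0 < u) by (apply Rmin_pos; [lra | apply exp_pos]).
  assert (Hu1 : u <= 1 / 2) by apply Rmin_l.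
  exists u; split; [lra |].
  assert (Hln : ln u <= - (M * C / k)).
  { rewrite <- (ln_exp (- (M * C / k))).
    apply ln_le; [easy | apply Rmin_r]. }
  assert (Hlog := zbF_ge_log a b (1 - u) Ha Hb Hab ltac:(lra)).
  replace (1 - (1 - u)) with u in Hlog by ring; fold k in Hlog.
  assert (HkM : k * (M * C / k) = M * C) by (field; lra).
  assert (HFu : zbF a b u <= C).
  { destruct (Rle_lt_or_eq_dec _ _ Hu1) as [Hlt | Heq];
      [|rewrite Heq; apply Rle_refl].
    apply Rlt_le.
    apply (incr_function (zbF a b) 0 1 (fun t => zbK a b t / (1 - t)));
      simpl; try lra.
    - intros t Ht0 Ht1; apply is_derive_zbF; try easy; rewrite Rabs_pos_eq; lra.
    - intros t Ht0 Ht1; apply Rlt_gt, Rdiv_lt_0_compat; [|lra].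
      apply zbK_pos; lra. }
  assert (HF := zbF_ge_1 a b u Ha Hb Hab ltac:(lra)).
  apply Rlt_div_r; [lra |].
  nra.
Qed.

(** * The substitution r = 1/cosh x *)

Lemma cosh_sqr (x : R) : cosh x ^ 2 = 1 + sinh x ^ 2.
Proof.
  unfold cosh, sinh.
  assert (H : exp x * exp (- x) = 1)
    by (rewrite <- exp_plus, Rplus_opp_r; apply exp_0).
  nra.
Qed.

Lemma cosh_pos (x : R) : 0 < cosh x.
Proof.
  unfold cosh.
  assert (H1 := exp_pos x); assert (H2 := exp_pos (- x)); lra.
Qed.

Lemma sinh_pos (x : R) : 0 < x -> 0 < sinh x.
Proof. intros Hx; rewrite <- sinh_0; now apply sinh_lt. Qed.

Lemma cosh_plus (x y : R) :
  cosh (x + y) = cosh x * cosh y + sinh x * sinh y.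
Proof.
  unfold cosh, sinh.
  rewrite Ropp_plus_distr, !exp_plus; field.
Qed.

Lemma inv_cosh_sqr_bounds (x : R) : 0 < x -> 0 < / cosh x ^ 2 < 1.
Proof.
  intros Hx.
  assert (Hs := sinh_pos x Hx); assert (Hc := cosh_sqr x).
  split; [apply Rinv_0_lt_compat; nra |].
  rewrite <- Rinv_1; apply Rinv_lt_contravar; nra.
Qed.

Lemma inv_cosh_sqr_decreasing (x y : R) :
  0 < x -> x < y -> / cosh y ^ 2 < / cosh x ^ 2.
Proof.
  intros Hx Hxy.
  assert (Hsx := sinh_pos x Hx); assert (Hs := sinh_lt x y Hxy).
  assert (Hcx := cosh_sqr x); assert (Hcy := cosh_sqr y).
  apply Rinv_lt_contravar; [apply Rmult_lt_0_compat |]; nra.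
Qed.

Lemma cosh_parametrization (r : R) : 0 < r < 1 ->
  exists x, 0 < x /\ r = 1 / cosh x /\ sqrt (1 - r ^ 2) = sinh x / cosh x.
Proof.
  intros Hr.
  set (r' := sqrt (1 - r ^ 2)).
  assert (Hr' : 0 < r') by (apply sqrt_lt_R0; nra).
  assert (Hsq : r' * r' = 1 - r ^ 2) by (apply sqrt_sqrt; nra).
  assert (Hq : 0 < r' / r) by (apply Rdiv_lt_0_compat; lra).
  assert (Hc := cosh_sqr (arcsinh (r' / r))).
  assert (Hcp := cosh_pos (arcsinh (r' / r))).
  rewrite sinh_arcsinh in Hc.
  assert (Hcosh : cosh (arcsinh (r' / r)) = 1 / r).
  { apply (Rsqr_inj _ _ (Rlt_le _ _ Hcp));
      [apply Rlt_le, Rdiv_lt_0_compat; lra |].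
    rewrite !Rsqr_pow2, Hc.
    replace ((r' / r) ^ 2) with (r' * r' / r ^ 2) by (field; lra).
    rewrite Hsq; field; lra. }
  exists (arcsinh (r' / r)); repeat split.
  - apply Rnot_le_lt; intros [Hlt | Heq].
    + assert (H := sinh_lt _ _ Hlt); rewrite sinh_arcsinh, sinh_0 in H; lra.
    + assert (H := sinh_arcsinh (r' / r)); rewrite Heq, sinh_0 in H; lra.
  - rewrite Hcosh; field; lra.
  - rewrite Hcosh, sinh_arcsinh; field; lra.
Qed.

(** * Concave functions on the positive half-line *)

Lemma strictly_concave_of_derive (f df : R -> R) :
  (forall x, 0 < x -> is_derive f x (df x)) ->
  (forall x y, 0 < x -> x < y -> df y < df x) ->
  forall x y t, 0 < x -> x < y -> 0 < t < 1 ->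
    t * f x + (1 - t) * f y < f (t * x + (1 - t) * y).
Proof.
  intros Hder Hdec x y t Hx Hxy Ht.
  set (z := t * x + (1 - t) * y).
  assert (Hxz : z - x = (1 - t) * (y - x)) by (unfold z; ring).
  assert (Hzy : y - z = t * (y - x)) by (unfold z; ring).
  assert (0 < (1 - t) * (y - x)) by (apply Rmult_lt_0_compat; lra).
  assert (0 < t * (y - x)) by (apply Rmult_lt_0_compat; lra).
  destruct (MVT_cor2 f df x z) as (p & Hp & Hpz);
    [lra | intros; apply is_derive_Reals, Hder; lra |].
  destruct (MVT_cor2 f df z y) as (q & Hq & Hqz);
    [lra | intros; apply is_derive_Reals, Hder; lra |].
  assert (Hpq : df q < df p) by (apply Hdec; lra).
  rewrite Hxz in Hp; rewrite Hzy in Hq.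
  assert (0 < t * ((1 - t) * (y - x)) * (df p - df q))
    by (repeat apply Rmult_lt_0_compat; lra).
  assert (t * (f z - f x) - (1 - t) * (f y - f z) =
          t * ((1 - t) * (y - x)) * (df p - df q)) by (rewrite Hp, Hq; ring).
  lra.
Qed.

Lemma concave_on_of_strict (f : R -> R) :
  (forall x y t, 0 < x -> x < y -> 0 < t < 1 ->
    t * f x + (1 - t) * f y < f (t * x + (1 - t) * y)) ->
  concave_on (fun x => 0 < x) f.
Proof.
  intros Hstrict x y t Hx Hy Ht.
  destruct (Req_dec t 0) as [-> | Ht0].
  { replace (0 * x + (1 - 0) * y) with y by ring; lra. }
  destruct (Req_dec t 1) as [-> | Ht1].
  { replace (1 * x + (1 - 1) * y) with x by ring; lra. }
  destruct (Rtotal_order x y) as [Hlt | [-> | Hgt]].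
  - apply Rlt_le, Hstrict; lra.
  - replace (t * y + (1 - t) * y) with y by ring; lra.
  - assert (H := Hstrict y x (1 - t) Hy Hgt ltac:(lra)).
    replace (1 - (1 - t)) with t in H by ring.
    rewrite (Rplus_comm (t * x)); lra.
Qed.

(** Equivalently, f(z)/z is nonincreasing: the chords from (e, f(e)) to a further
    point lie above the chords from the origin in the limit e -> 0, because
    f(e) >= 0. *)
Lemma concave_pos_div_decreasing (f : R -> R) (x y : R) :
  concave_on (fun x => 0 < x) f -> (forall x, 0 < x -> 0 < f x) ->
  0 < x -> 0 < y -> x * f (x + y) <= (x + y) * f x.
Proof.
  intros Hconc Hpos Hx Hy.
  (* compare f x with the chord from a point e near 0 to x + y *)
  assert (Hchord : forall e, 0 < e < x ->
    (x - e) * f (x + y) <= (x + y - e) * f x).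
  { intros e He.
    assert (H := Hconc (x + y) e ((x - e) / (x + y - e)) ltac:(lra) ltac:(lra)).
    replace ((x - e) / (x + y - e) * (x + y)
             + (1 - (x - e) / (x + y - e)) * e) with x in H by (field; lra).
    assert (Ht : 0 <= (x - e) / (x + y - e) <= 1).
    { split; [apply Rlt_le, Rdiv_lt_0_compat; lra |].
      apply Rle_div_l; lra. }
    specialize (H Ht).
    assert (0 <= (1 - (x - e) / (x + y - e)) * f e)
      by (apply Rmult_le_pos; [lra | apply Rlt_le, Hpos; lra]).
    replace ((x - e) * f (x + y))
      with ((x + y - e) * ((x - e) / (x + y - e) * f (x + y))) by (field; lra).
    apply Rmult_le_compat_l; lra. }
  apply Rnot_lt_le; intros Hlt.
  assert (Hp := Hpos (x + y) ltac:(lra)).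
  set (d := x * f (x + y) - (x + y) * f x) in *.
  assert (Hd : 0 < d) by (unfold d; lra).
  set (e := Rmin (x / 2) (d / (2 * f (x + y)))).
  assert (He : 0 < e)
    by (apply Rmin_pos; [lra | apply Rdiv_lt_0_compat; lra]).
  assert (He1 : e <= x / 2) by apply Rmin_l.
  assert (He2 : e * (2 * f (x + y)) <= d)
    by (apply Rle_div_r; [lra | apply Rmin_r]).
  specialize (Hchord e ltac:(lra)).
  assert (0 < e * f x) by (apply Rmult_lt_0_compat; [easy | now apply Hpos]).
  unfold d in *; lra.
Qed.

(** f(x) and f(y) are at least the fractions x/(x+y) and y/(x+y) of f(x+y). *)
Lemma concave_pos_subadditive (f : R -> R) (x y : R) :
  concave_on (fun x => 0 < x) f -> (forall x, 0 < x -> 0 < f x) ->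
  0 < x -> 0 < y -> f (x + y) <= f x + f y.
Proof.
  intros Hconc Hpos Hx Hy.
  assert (H1 := concave_pos_div_decreasing f x y Hconc Hpos Hx Hy).
  assert (H2 := concave_pos_div_decreasing f y x Hconc Hpos Hy Hx).
  rewrite (Rplus_comm y x) in H2.
  apply (Rmult_le_reg_l (x + y)); lra.
Qed.

(** * The composite of mu and 1/cosh *)

Definition mu_sech (a b x : R) : R := mu a (a + b) (1 / cosh x).

Lemma mu_sech_zb_ratio (a b x : R) :
  mu_sech a b x = Beta a b / 2 * zb_ratio a b (/ cosh x ^ 2).
Proof.
  unfold mu_sech, mu, zb_ratio, zbF, hyp2F1.
  replace (a + b - a) with b by ring.
  assert (Hc := cosh_pos x).
  now replace ((1 / cosh x) ^ 2) with (/ cosh x ^ 2) by (field; lra).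
Qed.

Lemma mu_sech_pos (a b x : R) : 0 < a -> 0 < b -> a + b <= 1 -> 0 < x ->
  0 < mu_sech a b x.
Proof.
  intros Ha Hb Hab Hx; rewrite mu_sech_zb_ratio.
  assert (Hu := inv_cosh_sqr_bounds x Hx).
  assert (HB := Beta_pos a b Ha Hb).
  assert (HF := zbF_ge_1 a b (/ cosh x ^ 2) Ha Hb Hab ltac:(lra)).
  assert (HFr := zbF_ge_1 a b (1 - / cosh x ^ 2) Ha Hb Hab ltac:(lra)).
  apply Rmult_lt_0_compat; [lra |].
  apply Rdiv_lt_0_compat; lra.
Qed.

Lemma is_derive_mu_sech (a b x : R) : 0 < a -> 0 < b -> a + b <= 1 -> 0 < x ->
  is_derive (mu_sech a b) x (Beta a b * zb_slope a b (/ cosh x ^ 2)).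
Proof.
  intros Ha Hb Hab Hx.
  assert (Hu := inv_cosh_sqr_bounds x Hx).
  assert (Hcosh := cosh_pos x); assert (Hs := sinh_pos x Hx).
  assert (Hcs := cosh_sqr x).
  assert (HF := zbF_ge_1 a b (/ cosh x ^ 2) Ha Hb Hab ltac:(lra)).
  apply (is_derive_ext
    (fun y => Beta a b / 2 * zb_ratio a b (/ cosh y ^ 2)));
    [intros y; now rewrite mu_sech_zb_ratio |].
  assert (Hdu : is_derive (fun y => / cosh y ^ 2) x
                  (- (2 * sinh x / cosh x ^ 3))).
  { evar_last.
    - apply is_derive_inv; [|apply pow_nonzero; lra].
      apply is_derive_pow, is_derive_Reals, derivable_pt_lim_cosh.
    - simpl; field; lra. }
  assert (Htanh : sqrt (1 - / cosh x ^ 2) = sinh x / cosh x).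
  { replace (1 - / cosh x ^ 2) with ((sinh x / cosh x) ^ 2).
    - apply sqrt_pow2, Rlt_le, Rdiv_lt_0_compat; lra.
    - replace ((sinh x / cosh x) ^ 2) with (sinh x ^ 2 / cosh x ^ 2)
        by (field; lra).
      replace (sinh x ^ 2) with (cosh x ^ 2 - 1) by lra; field; lra. }
  evar_last.
  - apply is_derive_scal, (is_derive_comp (zb_ratio a b));
      [now apply is_derive_zb_ratio | exact Hdu].
  - assert (H1u : 1 - / cosh x ^ 2 = sinh x ^ 2 / cosh x ^ 2).
    { replace (sinh x ^ 2) with (cosh x ^ 2 - 1) by lra; field; lra. }
    unfold zb_slope; rewrite Htanh, H1u.
    set (F := zbF a b (/ cosh x ^ 2)) in *.
    set (W := zb_wronskian a b (/ cosh x ^ 2)).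
    unfold scal; simpl; unfold mult; simpl; field; repeat split; lra.
Qed.

Lemma mu_sech_increasing (a b : R) : 0 < a -> 0 < b -> a + b <= 1 ->
  increasing_on (fun x => 0 < x) (mu_sech a b).
Proof.
  intros Ha Hb Hab x y Hx Hy Hxy.
  apply (incr_function (mu_sech a b) 0 p_infty
           (fun t => Beta a b * zb_slope a b (/ cosh t ^ 2))); simpl; try easy.
  - intros t Ht _; now apply is_derive_mu_sech.
  - intros t Ht _; apply Rmult_lt_0_compat; [now apply Beta_pos |].
    apply zb_slope_pos; try easy; now apply inv_cosh_sqr_bounds.
Qed.

Lemma mu_sech_strictly_concave (a b x y t : R) :
  0 < a -> 0 < b -> a + b <= 1 -> 0 < x -> x < y -> 0 < t < 1 ->
  t * mu_sech a b x + (1 - t) * mu_sech a b y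
    < mu_sech a b (t * x + (1 - t) * y).
Proof.
  intros Ha Hb Hab.
  apply (strictly_concave_of_derive (mu_sech a b)
           (fun t => Beta a b * zb_slope a b (/ cosh t ^ 2))).
  - intros; now apply is_derive_mu_sech.
  - intros u v Hu Huv.
    apply Rmult_lt_compat_l; [now apply Beta_pos |].
    apply zb_slope_increasing; try easy.
    + apply inv_cosh_sqr_bounds; lra.
    + now apply inv_cosh_sqr_decreasing.
    + now apply inv_cosh_sqr_bounds.
Qed.

Lemma mu_sech_onto (a b : R) : 0 < a -> 0 < b -> a + b <= 1 ->
  maps_onto (fun x => 0 < x) (fun y => 0 < y) (mu_sech a b).
Proof.
  intros Ha Hb Hab; split; [intros; now apply mu_sech_pos |].
  intros y Hy.
  assert (HB := Beta_pos a b Ha Hb).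
  assert (Hval : forall u, 0 < u < 1 ->
    exists x, 0 < x /\ mu_sech a b x = Beta a b / 2 * zb_ratio a b u).
  { intros u Hu.
    assert (Hsu : 0 < sqrt u < 1).
    { split; [apply sqrt_lt_R0; lra |].
      rewrite <- sqrt_1; apply sqrt_lt_1; lra. }
    destruct (cosh_parametrization _ Hsu) as (x & Hx & Hr & _).
    exists x; split; [easy |].
    rewrite mu_sech_zb_ratio; do 2 f_equal.
    assert (Hc := cosh_pos x).
    replace (/ cosh x ^ 2) with ((1 / cosh x) ^ 2) by (field; lra).
    rewrite <- Hr; apply pow2_sqrt; lra. }
  destruct (zb_ratio_unbounded a b (2 * y / Beta a b)) as (u & Hu & HuM);
    try easy; [apply Rdiv_lt_0_compat; lra |].
  destruct (zb_ratio_unbounded a b (Beta a b / (2 * y))) as (v & Hv & HvM);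
    try easy; [apply Rdiv_lt_0_compat; lra |].
  destruct (Hval u Hu) as (x2 & Hx2 & Hfx2).
  destruct (Hval (1 - v) ltac:(lra)) as (x1 & Hx1 & Hfx1).
  assert (Hhigh : y < mu_sech a b x2).
  { apply (Rlt_div_l _ _ _ HB) in HuM; lra. }
  assert (Hlow : mu_sech a b x1 < y).
  { (* the ratio is inverted by u -> 1 - u *)
    assert (HF := zbF_ge_1 a b v Ha Hb Hab ltac:(lra)).
    assert (HFr := zbF_ge_1 a b (1 - v) Ha Hb Hab ltac:(lra)).
    rewrite Hfx1; unfold zb_ratio in *.
    replace (1 - (1 - v)) with v by ring.
    apply Rlt_div_r in HvM; [|lra].
    replace (Beta a b / 2 * (zbF a b v / zbF a b (1 - v)))
      with (y * (Beta a b / (2 * y) * zbF a b v) / zbF a b (1 - v))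
      by (field; lra).
    apply Rlt_div_l; [lra |].
    now apply Rmult_lt_compat_l. }
  assert (Hx12 : x1 < x2).
  { apply Rnot_le_lt; intros [Hlt | Heq].
    - assert (H := mu_sech_increasing a b Ha Hb Hab x2 x1 Hx2 Hx1 Hlt); lra.
    - subst x2; lra. }
  assert (Hcont : forall x, 0 < x -> continuity_pt (mu_sech a b) x).
  { intros x Hx; apply derivable_continuous_pt.
    eexists; now apply is_derive_Reals, is_derive_mu_sech. }
  destruct (IVT_interv (fun x => mu_sech a b x - y) x1 x2)
    as (x & Hx & Hxy); try lra.
  - intros x Hx; apply continuity_pt_minus;
      [apply Hcont; lra | apply continuity_pt_const; now intros ? ?].
  - exists x; lra.
Qed.

Lemma inv_cosh_plus (x y : R) :
  1 / cosh x * (1 / cosh y) /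
    (1 + sinh x / cosh x * (sinh y / cosh y)) = 1 / cosh (x + y).
Proof.
  assert (Hx := cosh_pos x); assert (Hy := cosh_pos y).
  assert (Hxy := cosh_pos (x + y)).
  rewrite cosh_plus in *; field; lra.
Qed.

(** The duplication formula: cosh(x+y) + 1 = 2 cosh((x+y)/2)^2. *)
Lemma inv_cosh_half_plus (x y : R) :
  sqrt (2 * (1 / cosh x) * (1 / cosh y) /
    (1 + 1 / cosh x * (1 / cosh y) + sinh x / cosh x * (sinh y / cosh y)))
  = 1 / cosh ((x + y) / 2).
Proof.
  assert (Hx := cosh_pos x); assert (Hy := cosh_pos y).
  assert (Hh := cosh_pos ((x + y) / 2)).
  assert (Hxy := cosh_plus x y).
  assert (Hdbl := cosh_plus ((x + y) / 2) ((x + y) / 2)).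
  assert (Hsq := cosh_sqr ((x + y) / 2)).
  replace ((x + y) / 2 + (x + y) / 2) with (x + y) in Hdbl by field.
  set (h := cosh ((x + y) / 2)) in *.
  assert (Hsum : cosh x * cosh y + sinh x * sinh y + 1 = 2 * h ^ 2) by nra.
  assert (0 < h ^ 2) by (apply pow_lt; lra).
  rewrite <- (sqrt_pow2 (1 / h)) by (apply Rlt_le, Rdiv_lt_0_compat; lra).
  f_equal.
  transitivity (2 / (cosh x * cosh y + sinh x * sinh y + 1)).
  - field; repeat split; lra.
  - rewrite Hsum; field; lra.
Qed.

Theorem theorem4p3 (a c : R) (ha : 0 < a) (hac : a < c) (hc : c <= 1) :
  (increasing_on (fun x => 0 < x) (fun x => mu a c (1 / cosh x)) /\
   concave_on (fun x => 0 < x) (fun x => mu a c (1 / cosh x)) /\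
   maps_onto (fun x => 0 < x) (fun y => 0 < y)
     (fun x => mu a c (1 / cosh x))) /\
  (forall r s : R, 0 < r < 1 -> 0 < s < 1 ->
     let r' := sqrt (1 - r ^ 2) in
     let s' := sqrt (1 - s ^ 2) in
     mu a c (r * s / (1 + r' * s')) <= mu a c r + mu a c s /\
     mu a c r + mu a c s
       <= 2 * mu a c (sqrt (2 * r * s / (1 + r * s + r' * s'))) /\
     (mu a c r + mu a c s
        = 2 * mu a c (sqrt (2 * r * s / (1 + r * s + r' * s'))) <-> r = s)).
Proof.
  set (b := c - a).
  assert (Hb : 0 < b) by (unfold b; lra).
  assert (Hab : a + b <= 1) by (unfold b; lra).
  assert (Hc : c = a + b) by (unfold b; ring).
  clearbody b; subst c.
  assert (Hconc : concave_on (fun x => 0 < x) (mu_sech a b)).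
  { apply concave_on_of_strict; intros; now apply mu_sech_strictly_concave. }
  split; [split; [|split] |].
  - now apply mu_sech_increasing.
  - exact Hconc.
  - now apply mu_sech_onto.
  - intros r s Hr Hs r' s'; unfold r', s'.
    destruct (cosh_parametrization r Hr) as (x & Hx & Hrx & ->).
    destruct (cosh_parametrization s Hs) as (y & Hy & Hsy & ->).
    rewrite Hrx, Hsy, inv_cosh_plus, inv_cosh_half_plus.
    fold (mu_sech a b x) (mu_sech a b y) (mu_sech a b (x + y))
      (mu_sech a b ((x + y) / 2)).
    assert (Hmid : forall x y, 0 < x -> x < y ->
      mu_sech a b x + mu_sech a b y < 2 * mu_sech a b ((x + y) / 2)).
    { intros u v Hu Huv.
      assert (H := mu_sech_strictly_concave a b u v (1 / 2) ha Hb Hab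
                     Hu Huv ltac:(lra)).
      replace (1 / 2 * u + (1 - 1 / 2) * v) with ((u + v) / 2) in H by field.
      lra. }
    split; [|split].
    + apply concave_pos_subadditive; try easy.
      intros; now apply mu_sech_pos.
    + assert (H := Hconc x y (1 / 2) Hx Hy ltac:(lra)).
      replace (1 / 2 * x + (1 - 1 / 2) * y) with ((x + y) / 2) in H by field.
      lra.
    + split; [|intros Hrs].
      * intros Heq.
        destruct (Rtotal_order x y) as [Hlt | [-> | Hgt]]; [| easy |].
        -- specialize (Hmid x y Hx Hlt); lra.
        -- specialize (Hmid y x Hy Hgt); rewrite (Rplus_comm y x) in Hmid; lra.
      * assert (Hxy : x = y).
        { assert (Hcx := cosh_pos x); assert (Hcy := cosh_pos y).
          assert (Hsq : / cosh x ^ 2 = / cosh y ^ 2).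
          { replace (/ cosh x ^ 2) with ((1 / cosh x) ^ 2) by (field; lra).
            rewrite Hrs; field; lra. }
          destruct (Rtotal_order x y) as [Hlt | [Heq | Hgt]]; [| easy |].
          - assert (H := inv_cosh_sqr_decreasing x y Hx Hlt); lra.
          - assert (H := inv_cosh_sqr_decreasing y x Hy Hgt); lra. }
        subst y; replace ((x + x) / 2) with x by field; ring.
Qed.
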